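(* Let $z>0$, $0<w_N<w_I\le z/2$, $d:=w_I-w_N$, $i>0$, $n_n>n_h>0$, and set $c_h:=i+n_h$, $c_n:=i+n_n$, $I:=2i$, $C:=c_h+c_n$. Let $$\bar\delta:=\frac{i(n_n-n_h)}{2(i+n_n)},\qquad 0<\delta<\bar\delta .$$ Let $D(b)=b\log\cosh\left(\frac{z}{2b}\right)$ for $b>0$, let $b_0>0$ be the unique number with $D(b_0)=w_N$, and let $a(b):=w_N-D(b)>0$ for $b>b_0$. For $m>0$ and $b>b_0$, let $\Gamma(\ell_h,\ell_n;b,m)$, the directional (SCF) program with value $\Gamma_D(b;m)$ and the uniform program with value $\Gamma_U(b;m)$ be as defined in the context. Then for every $m>0$ and $b>b_0$ the directional program has the unique optimizer $$\ell_h^D(b)=0,\qquad \ell_n^D(b)=\frac{\delta a(b)}{i},$$ and the uniform program has the unique optimizer $$\ell^U(b)=\frac{\delta a(b)}{2i}.$$ Writing $\Gamma_M(b;m)=mG_M(b)$ for $M\in\{D,U\}$, one has $$G_D(b)=\delta d\,a(b)+c_n a(b)^2\left(\frac{\delta}{i}-\frac{\delta^2}{i^2}\right),\qquad G_U(b)=\delta d\,a(b)+C a(b)^2\left(\frac{\delta}{I}-\frac{\delta^2}{I^2}\right),$$ and $0<G_U(b)<G_D(b)$ for every $b>b_0$. Moreover, let $$\Psi_M(b):=\frac{G_M(b)}{b\log 2},\qquad S_M:=\max_{b>b_0}\Psi_M(b)\qquad (M\in\{D,U\}).$$ Both maxima are finite, positive, and attained at points of the open interval $(b_0,\infty)$,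 and $0<S_U<S_D<\infty$. Finally, for $m>0$ let $$\mathcal{B}_M(m):=\{b>b_0:\ mG_M(b)\ge b\log 2\}\qquad (M\in\{D,U\}).$$ Then: (i) if $0<m<1/S_D$, then $\mathcal{B}_D(m)=\mathcal{B}_U(m)=\varnothing$; (ii) if $1/S_D\le m<1/S_U$, then $\mathcal{B}_D(m)\neq\varnothing$ and $\mathcal{B}_U(m)=\varnothing$; (iii) if $m\ge 1/S_U$, then $\mathcal{B}_U(m)\subsetneq\mathcal{B}_D(m)$.
   Context: Setting: a binary logarithmic market scoring rule (LMSR) market with liquidity parameter $b>0$. $D(b)$ is the cost of a fixed lot of risky size $z$ in either payoff direction $s\in\{h,n\}$ from the symmetric initial state, and $b\log 2$ is the prefunded seed capital (worst-case loss). The function $D$ is continuous and strictly decreasing on $(0,\infty)$ with limits $z/2$ at $0$ and $0$ at $\infty$, so $b_0$ is well defined and $a(b)>0$ for $b>b_0$. At arrival scale $m>0$, potential orders of type informed ($\mathrm{I}$) and noise ($\mathrm{N}$) in direction $s\in\{h,n\}$ have raw advantage $W$ with uniform intensity: $m\,i\,dW$ on $[0,w_I]$ for informed orders in either direction, and $m\,n_s\,dW$ on $[0,w_N]$ for noise orders in direction $s$. With levy $\ell_s\in[0,a(b)]$ an order executes exactly when $W\ge D(b)+\ell_s$, so the demands are $$Q_{\mathrm{I},s}=m\,i\,[a(b)+d-\ell_s],\qquad Q_{\mathrm{N},s}=m\,n_s\,[a(b)-\ell_s].$$ Expected levy revenue is $$\Gamma(\ell_h,\ell_n;b,m)=\sum_{s\in\{h,n\}}\ell_s\,[Q_{\mathrm{I},s}+Q_{\mathrm{N},s}]=m\sum_{s\in\{h,n\}}\Big(i\,d\,\ell_s+c_s\ell_s[a(b)-\ell_s]\Big).$$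 Directional (SCF) program: $\Gamma_D(b;m):=\max_{\ell_h,\ell_n}\Gamma(\ell_h,\ell_n;b,m)$ subject to $i(\ell_h+\ell_n)\le\delta a(b)$ and $0\le\ell_h,\ell_n\le a(b)$. Uniform program: $\Gamma_U(b;m):=\max_{\ell}\Gamma(\ell,\ell;b,m)$ subject to $2i\ell\le\delta a(b)$ and $0\le\ell\le a(b)$. The labels $D$ and $U$ as subscripts/superscripts on $\Gamma,G,\Psi,S,\mathcal{B},\ell$ stand for ''directional'' and ''uniform'' (not the function $D(b)$). *)

(* Defs.v *)
From HB Require Import structures.
From mathcomp Require Import all_boot all_order all_algebra.
From mathcomp Require Import all_classical all_reals all_analysis.
Set Implicit Arguments.
Unset Strict Implicit.
Unset Printing Implicit Defensive.
Import Order.TTheory GRing.Theory Num.Theory.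
Import numFieldNormedType.Exports.
Local Open Scope classical_set_scope.
Local Open Scope ring_scope.

Definition cosh (R : realType) (x : R) : R := (expR x + expR (- x)) / 2.

(* Cost of a lot of size z, in either payoff direction, in the binary LMSR
   with liquidity b started at its symmetric state. *)
Definition lmsr_cost (R : realType) (z b : R) : R := b * ln (cosh (z / (2 * b))).

(* Executed demand of orders whose raw advantage W has constant intensity
   lam dW on [0, w]: an order executes iff its advantage covers the all-in
   charge t, i.e. the execution cost plus the levy. *)
Definition demand (R : realType) (w lam t : R) : R :=
  \int[lebesgue_measure]_(W in `[0, w] `&` [set W | t <= W]) lam.

Lemma demandE (R : realType) (w lam t : R) :
  0 <= t <= w -> demand w lam t = lam * (w - t).
Proof.
move=> /andP[t0 tw]; rewrite /demand.
rewrite (_ : _ `&` _ = [set` `[t, w]]); last first.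
  apply/seteqP; split => x /=; rewrite !in_itv /=.
    by case=> /andP[_ ->] ->.
  by move=> /andP[tx ->]; rewrite tx (le_trans t0 tx).
rewrite Rintegral_cst//= lebesgue_measure_itv/= lte_fin.
by case: ltgtP tw => [//|//|->]; rewrite subrr.
Qed.

(* Expected levy revenue at the levy pair l = (l_h, l_n) and execution cost D. *)
Definition levy_revenue (R : realType) (wI wN i nh nn D m : R) (l : R * R) : R :=
  l.1 * (demand wI (m * i) (D + l.1) + demand wN (m * nh) (D + l.1)) +
  l.2 * (demand wI (m * i) (D + l.2) + demand wN (m * nn) (D + l.2)).

Definition dir_feasible (R : realType) (i delta a : R) : set (R * R) :=
  [set l | [/\ i * (l.1 + l.2) <= delta * a, 0 <= l.1 <= a & 0 <= l.2 <= a]].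

Definition unif_feasible (R : realType) (i delta a : R) : set R :=
  [set l | 2 * i * l <= delta * a /\ 0 <= l <= a].

Definition argmax (R : realType) (T : Type) (A : set T) (f : T -> R) : set T :=
  [set x | A x /\ forall y, A y -> f y <= f x].

(* This is the maximum of f on A as soon as argmax A f is nonempty. *)
Definition maxval (R : realType) (T : Type) (A : set T) (f : T -> R) : R :=
  sup (f @` A).

(* Main.v *)
(* The strict convexity of exp gives ln (cosh (t x)) < t ln (cosh x) for
   0 < t < 1, i.e. the cost D is strictly decreasing.  As delta is small, the
   levy mass put on the direction with more noise orders earns strictly more at
   the margin, so the directional optimum puts all of it there.  Each G_M is
   alpha a + beta a^2 with alpha, beta > 0, hence Psi_M vanishes at b_0 and is
   O(1/b), and its maximum is attained in between.  Strictness in (iii) comes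
   from a point where Psi_D = 1/m, found between b_0 and the maximizer of Psi_U:
   there Psi_U < 1/m. *)
Require Import Defs.
From HB Require Import structures.
From mathcomp Require Import all_boot all_order all_algebra.
From mathcomp Require Import all_classical all_reals all_analysis.
From mathcomp Require Import ring lra.
Set Implicit Arguments.
Unset Strict Implicit.
Unset Printing Implicit Defensive.
Import Order.TTheory GRing.Theory Num.Theory.
Import numFieldNormedType.Exports.
Local Open Scope classical_set_scope.
Local Open Scope ring_scope.

(** * Maxima and maximizers on a set *)

Lemma maxval_argmax (R : realType) (T : Type) (A : set T) (f : T -> R) (x : T) :
  argmax A f x -> maxval A f = f x.
Proof.
move=> [Ax fx]; apply/le_anti/andP; split.
  by apply: ge_sup; [exists (f x), x | move=> _ [y Ay <-]; exact: fx].
by apply: ub_le_sup; [exists (f x) => _ [y Ay <-]; exact: fx | exists x].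
Qed.

(** Agreement is asked on [A] only, because the closed forms of the ratios [PsiD] and [PsiU] are
    established only for [b0 < b]. *)
Lemma eq_maxval (R : realType) (T : Type) (A : set T) (f g : T -> R) :
  (forall x, A x -> f x = g x) -> maxval A f = maxval A g.
Proof.
move=> fg; congr sup; apply/seteqP; split=> _ [x Ax <-]; exists x => //.
  exact/esym/fg.
exact: fg.
Qed.

Lemma eq_argmax (R : realType) (T : Type) (A : set T) (f g : T -> R) :
  (forall x, A x -> f x = g x) -> argmax A f = argmax A g.
Proof.
move=> fg; apply/seteqP; split=> x [Ax fx]; split=> // y Ay.
  by rewrite -!fg//; exact: fx.
by rewrite !fg//; exact: fx.
Qed.

Lemma argmax_unique (R : realType) (T : Type) (A : set T) (f : T -> R) (x : T) :
  A x -> (forall y, A y -> y <> x -> f y < f x) -> argmax A f = [set x].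
Proof.
move=> Ax fx; apply/seteqP; split => [y [Ay fy]|_ ->] /=.
  by apply: contrapT => yx; have := fx _ Ay yx; rewrite ltNge fy.
by split=> // y Ay; have [->//|yx] := pselect (y = x); exact/ltW/fx.
Qed.

(** The tangent bound [1 + u < expR u] is averaged over [u = (1 - t) * y] and [u = - t * y] with
    weights [t] and [1 - t]. The linear terms cancel, and multiplying by [expR (t * y)] gives the
    claim. *)
Lemma expR_strict_convex (R : realType) (t y : R) :
  0 < t < 1 -> y != 0 -> expR (t * y) < 1 - t + t * expR y.
Proof.
move=> /andP[t0 t1] y0.
have ht : 0 < 1 - t by rewrite subr_gt0.
have h1 : 1 + (1 - t) * y < expR ((1 - t) * y).
  by apply: expR_gt1Dx; rewrite mulf_neq0// gt_eqF.
have h2 : 1 + - t * y < expR (- t * y).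
  by apply: expR_gt1Dx; rewrite mulf_neq0// oppr_eq0 gt_eqF.
have e0 := expR_gt0 (t * y).
have E1 : expR y = expR (t * y) * expR ((1 - t) * y).
  by rewrite -expRD; congr expR; ring.
have E2 : expR (t * y) * expR (- t * y) = 1.
  by rewrite -expRD -[RHS]expR0; congr expR; ring.
rewrite E1.
have -> : 1 - t + t * (expR (t * y) * expR ((1 - t) * y)) =
    expR (t * y) * ((1 - t) * expR (- t * y) + t * expR ((1 - t) * y)).
  by rewrite mulrDr [X in _ = X + _]mulrCA E2; ring.
by rewrite ltr_pMr//; nra.
Qed.

(** * Estimates for the hyperbolic cosine *)

Section Cosh.
Variable R : realType.
Implicit Types x t : R.

Lemma cosh_gt1 x : x != 0 -> 1 < cosh x.
Proof.
move=> x0; have h1 := expR_gt1Dx x0.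
have h2 : 1 + - x < expR (- x) by apply: expR_gt1Dx; rewrite oppr_eq0.
by rewrite /cosh; lra.
Qed.

Lemma expR_div2_lt_cosh x : expR x / 2 < cosh x.
Proof. by have := expR_gt0 (- x); rewrite /cosh; lra. Qed.

(** The excess [cosh x - 1] equals [expR x * (1 - expR (- x)) ^+ 2 / 2], where
    [0 <= 1 - expR (- x) <= x] and [expR x <= expR 1]. *)
Lemma cosh_le1D_sqr x : 0 <= x <= 1 -> cosh x <= 1 + expR 1 * x ^+ 2 / 2.
Proof.
move=> /andP[x0 x1].
have h := expR_ge1Dx (- x).
have hx : expR x <= expR 1 by rewrite ler_expR.
have hN : 0 < expR (- x) <= 1 by rewrite expR_gt0 expR_le1; lra.
have E : expR x * expR (- x) = 1 by rewrite -expRD subrr expR0.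
have e0 := expR_gt0 x.
have -> : cosh x = 1 + expR x * (1 - expR (- x)) ^+ 2 / 2.
  by rewrite /cosh; nra.
have : (1 - expR (- x)) ^+ 2 <= x ^+ 2 by nra.
by nra.
Qed.

(** This is the strict power mean inequality for [expR x] and [expR (- x)], normalized by their mean
    [cosh x = expR L]. *)
Lemma ln_cosh_scale_lt t x : 0 < t < 1 -> x != 0 -> ln (cosh (t * x)) < t * ln (cosh x).
Proof.
move=> t01 x0.
have c1 := cosh_gt1 x0.
have c0 : 0 < cosh x by lra.
have /andP[t0 t1] := t01.
have tx0 : t * x != 0 by rewrite mulf_neq0// gt_eqF.
have c0' : 0 < cosh (t * x) by have := cosh_gt1 tx0; lra.
set L := ln (cosh x).
rewrite -ltr_expR lnK ?posrE//.
have LE : expR L = cosh x by rewrite lnK ?posrE.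
(* The exponentials of [x - L] and [- x - L] average to 1. *)
have hw y : expR (t * (y - L)) <= 1 - t + t * expR (y - L).
  have [->|y0] := eqVneq (y - L) 0; first by rewrite mulr0 expR0; lra.
  exact/ltW/expR_strict_convex.
have [E1 E2] : expR (x - L) * cosh x = expR x /\ expR (- x - L) * cosh x = expR (- x).
  by split; rewrite -LE -expRD; congr expR; ring.
have sum2 : expR (x - L) + expR (- x - L) = 2.
  apply: (mulIf (lt0r_neq0 c0)); rewrite mulrDl E1 E2 /cosh; lra.
(* As [x != 0], the exponents [x - L] and [- x - L] cannot both vanish, so convexity is strict in at
   least one of the two terms. *)
have hlt : expR (t * (x - L)) + expR (t * (- x - L)) < 2.
  have [e|n] := eqVneq (x - L) 0.
    have : - x - L != 0.
      apply/eqP => e'; move/eqP: x0; apply; lra.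
    by move=> /(expR_strict_convex t01); have := hw x; nra.
  by have := expR_strict_convex t01 n; have := hw (- x); nra.
have e0 := expR_gt0 (t * L).
have -> : cosh (t * x) =
    (expR (t * (x - L)) + expR (t * (- x - L))) / 2 * expR (t * L).
  have -> : (expR (t * (x - L)) + expR (t * (- x - L))) / 2 * expR (t * L) =
    (expR (t * (x - L)) * expR (t * L) + expR (t * (- x - L)) * expR (t * L)) / 2.
    by ring.
  by rewrite -!expRD /cosh; congr ((expR _ + expR _) / 2); ring.
nra.
Qed.

Lemma continuous_cosh : continuous (@cosh R).
Proof.
move=> x; rewrite /cosh; apply: cvgM; last exact: cvg_cst.
apply: cvgD; first exact: continuous_expR.
apply: (@continuous_comp _ _ _ (fun y : R => - y) expR); first exact: opp_continuous.
exact: continuous_expR.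
Qed.

End Cosh.

(** * Monotonicity, bounds and range of the LMSR cost *)

Section LmsrCost.
Variable R : realType.
Implicit Types z b c w : R.

Lemma lmsr_cost_gt0 z b : 0 < z -> 0 < b -> 0 < lmsr_cost z b.
Proof.
move=> z0 b0; rewrite mulr_gt0// ln_gt0// cosh_gt1//.
by rewrite gt_eqF// divr_gt0// mulr_gt0.
Qed.

(** Passing from [b] to [c] scales the argument of [cosh] by [b / c < 1], so the strict scaling
    inequality applies with [t = b / c]. *)
Lemma lmsr_cost_lt z b c : 0 < z -> 0 < b -> b < c -> lmsr_cost z c < lmsr_cost z b.
Proof.
move=> z0 b0 bc; have c0 : 0 < c by lra.
have := @ln_cosh_scale_lt R (b / c) (z / (2 * b)).
rewrite divr_gt0//= ltr_pdivrMr// mul1r bc => /(_ isT).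
rewrite gt_eqF ?divr_gt0 ?mulr_gt0// => /(_ isT).
rewrite (_ : b / c * (z / (2 * b)) = z / (2 * c)); last by field; lra.
by rewrite -(ltr_pM2l c0) => /lt_le_trans; apply; rewrite /lmsr_cost mulrA mulrCA divff ?mulr1// gt_eqF.
Qed.

(** Taking logarithms in [expR x / 2 < cosh x] gives the bound, which brings the cost close to
    [z / 2] for small [b]. *)
Lemma lmsr_cost_gt z b : 0 < b -> z / 2 - b * ln 2 < lmsr_cost z b.
Proof.
move=> b0; set x := z / (2 * b).
have -> : z / 2 = b * x by rewrite /x; field; lra.
rewrite -mulrBr /lmsr_cost ltr_pM2l// -ltr_expR expRD expRN !lnK ?posrE//.
  exact: expR_div2_lt_cosh.
by apply: lt_trans (expR_div2_lt_cosh x); rewrite divr_gt0 ?expR_gt0.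
Qed.

(** For such [b] the argument of [cosh] lies in [[0, 1]]. The quadratic bound on [cosh] and
    [ln (1 + u) <= u] then yield decay of order [1 / b]. *)
Lemma lmsr_cost_le z b : 0 < z -> z / 2 <= b -> lmsr_cost z b <= expR 1 * z ^+ 2 / (8 * b).
Proof.
move=> z0 zb; have b0 : 0 < b by lra.
set x := z / (2 * b).
have x01 : 0 <= x <= 1.
  apply/andP; split; first by apply: divr_ge0; lra.
  by rewrite /x ler_pdivrMr ?mulr_gt0//; lra.
have -> : expR 1 * z ^+ 2 / (8 * b) = b * (expR 1 * x ^+ 2 / 2).
  by rewrite /x; field; lra.
rewrite /lmsr_cost ler_pM2l//.
have h : 0 <= expR 1 * x ^+ 2 / 2 :> R by rewrite divr_ge0// mulr_ge0 ?sqr_ge0 ?expR_ge0.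
apply: le_trans (le_ln1Dx _); last by lra.
rewrite ler_ln ?posrE ?cosh_le1D_sqr//; last by lra.
by apply: lt_trans (expR_div2_lt_cosh x); rewrite divr_gt0 ?expR_gt0.
Qed.

Lemma continuous_lmsr_cost z b : 0 < b -> {for b, continuous (lmsr_cost z)}.
Proof.
move=> b0; apply: (@cvgM _ _ _ _ (fun y : R => y)); first exact: cvg_id.
apply: (@continuous_comp _ _ _ (fun y : R => z / (2 * y)) (fun y => ln (cosh y))).
  apply: cvgM; first exact: cvg_cst.
  apply: cvgV; first by rewrite gt_eqF// mulr_gt0.
  by apply: cvgM; [exact: cvg_cst | exact: cvg_id].
apply: (@continuous_comp _ _ _ (@cosh R) (@ln R)); first exact: continuous_cosh.
apply: continuous_ln.
by apply: lt_trans (expR_div2_lt_cosh _); rewrite divr_gt0 ?expR_gt0.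
Qed.

Lemma lmsr_cost_surj z w : 0 < z -> 0 < w < z / 2 -> exists2 b, 0 < b & lmsr_cost z b = w.
Proof.
move=> z0 /andP[w0 wz].
have l2 : 0 < ln 2 :> R by rewrite ln_gt0// ltr1n.
(* Here the lower bound [z / 2 - b * ln 2] equals [w]. *)
pose b1 := (z / 2 - w) / ln 2.
have b10 : 0 < b1 by rewrite divr_gt0// subr_gt0.
have D1 : w < lmsr_cost z b1.
  apply: le_lt_trans (lmsr_cost_gt z b10).
  by rewrite /b1 divfK ?gt_eqF//; lra.
(* The first summand makes the upper bound applicable, the second brings that bound down to at most
   [w]. *)
pose b2 := z / 2 + expR 1 * z ^+ 2 / (8 * w).
have e0 : 0 < expR 1 * z ^+ 2 / (8 * w).
  by rewrite divr_gt0 ?mulr_gt0 ?exprn_gt0 ?expR_gt0.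
have D2 : lmsr_cost z b2 <= w.
  apply: le_trans (lmsr_cost_le z0 _) _; first by rewrite /b2; lra.
  have b20 : 0 < b2 by rewrite /b2; lra.
  rewrite ler_pdivrMr ?mulr_gt0//.
  have -> : w * (8 * b2) = 4 * w * z + expR 1 * z ^+ 2 by rewrite /b2; field; lra.
  nra.
have b12 : b1 <= b2.
  rewrite leNgt; apply/negP => b21.
  have : 0 < b2 by rewrite /b2; lra.
  by move=> /(lmsr_cost_lt z0) /(_ b21); lra.
have [||c /[!in_itv]/= /andP[b1c _] cE] := @IVT R (lmsr_cost z) b1 b2 w b12.
- apply: continuous_in_subspaceT => y /[!inE]/=.
  rewrite in_itv/= => /andP[b1y _]; apply: continuous_lmsr_cost.
  exact: lt_le_trans b1y.
- by rewrite ge_min D2 orbT le_max (ltW D1).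
- by exists c => //; exact: lt_le_trans b1c.
Qed.

End LmsrCost.

(** * Optimizers and values of the two levy programs *)

Section LevyPrograms.
Variables (R : realType) (wI wN i nh nn delta : R).
Hypotheses (wNI : wN < wI) (i0 : 0 < i) (nh0 : 0 < nh) (nhn : nh < nn).
Hypotheses (delta0 : 0 < delta) (deltabar : delta < i * (nn - nh) / (2 * (i + nn))).
Variables (m D : R).
Hypotheses (m0 : 0 < m) (D0 : 0 < D) (DwN : D < wN).
Let a := wN - D.
Let d := wI - wN.

(** The bounds keep each charge [D + l] within [[0, wN]], hence also within [[0, wI]], where both
    demands are linear. *)
Lemma levy_revenueE (l : R * R) : 0 <= l.1 <= a -> 0 <= l.2 <= a ->
  levy_revenue wI wN i nh nn D m l =
  m * (i * d * (l.1 + l.2) + (i + nh) * l.1 * (a - l.1) + (i + nn) * l.2 * (a - l.2)).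
Proof.
move: D0 DwN wNI => D_gt0 D_lt wN_lt; rewrite /levy_revenue /a /d => /andP[x0 xa] /andP[y0 ya].
rewrite !demandE; first ring.
all: by apply/andP; split; lra.
Qed.

(** With [e = delta / i], this says [i + nh < (i + nn) * (1 - 2 * e)]: marginal revenue in direction
    [n] at the cap [e * a] still exceeds that in direction [h] at levy zero. *)
Lemma levy_cap_lt : delta / i * (2 * (i + nn)) < nn - nh.
Proof.
move: i0 nh0 nhn deltabar => i_gt0 nh_gt0 nh_lt; rewrite ltr_pdivlMr ?mulr_gt0//; last by lra.
by rewrite mulrAC ltr_pdivrMr// [ltRHS]mulrC.
Qed.

(** Since [nn - nh < i + nn], the previous bound leaves the cap below [a / 2], the vertex of
    [l * (a - l)]. *)
Lemma levy_cap_lt_half : 0 < delta / i < 1 / 2.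
Proof.
move: i0 nh0 nhn => i_gt0 nh_gt0 nh_lt; have cn0 : 0 < 2 * (i + nn) by lra.
rewrite divr_gt0//= -(ltr_pM2r cn0); apply: lt_trans levy_cap_lt _; lra.
Qed.

Lemma argmax_directional :
  argmax (dir_feasible i delta a) (levy_revenue wI wN i nh nn D m)
  = [set (0, delta * a / i)].
Proof.
move: i0 nh0 nhn => i_gt0 nh_gt0 nh_lt.
have a0 : 0 < a by rewrite subr_gt0.
have d0 : 0 < d by rewrite subr_gt0.
have := levy_cap_lt; have /andP := levy_cap_lt_half.
have -> : delta * a / i = delta / i * a by rewrite mulrAC.
set e := delta / i => -[e0 e1] ecap.
have ea : 0 <= e * a <= a by apply/andP; split; nra.
have feas : i * (0 + e * a) <= delta * a.
  by rewrite add0r mulrA mulrCA divff ?mulr1// gt_eqF.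
apply: argmax_unique => [|[x y] /= [xy xa ya] neq].
  by split=> //=; rewrite ?lexx ltW.
rewrite !levy_revenueE//= ?lexx ?(ltW a0)// ltr_pM2l//.
have {}xy : x + y <= e * a by rewrite mulrAC ler_pdivlMr// mulrC.
case/andP: xa => /= x0 xa; case/andP: ya => /= y0 ya.
(* Moving levy mass [x] from [h] to [n] gains at least
   [x * ((i + nn) * (a - 2 * L) - (i + nh) * a)], where [L = e * a] is the cap. *)
set L := e * a in xy ea neq *.
have gap : 0 < (i + nn) * (a - 2 * L) - (i + nh) * a by rewrite /L; nra.
have L2 : 0 < a - 2 * L by rewrite /L; nra.
have [r r0 yE] : exists2 r : R, 0 <= r & y = L - x - r.
  by exists (L - x - y); [lra | ring].
rewrite -subr_gt0.
have -> : i * d * (0 + L) + (i + nh) * 0 * (a - 0) + (i + nn) * L * (a - L) -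
   (i * d * (x + y) + (i + nh) * x * (a - x) + (i + nn) * y * (a - y)) =
   i * d * r + (i + nn) * r * (a - 2 * L + x + r) +
   x * ((i + nn) * (a - 2 * L) - (i + nh) * a) + (i + nh) * x ^+ 2
   + (i + nn) * x * (x + r).
  by rewrite yE; ring.
have cn0 : 0 < i + nn by lra.
have t1 : 0 <= (i + nn) * r * (a - 2 * L + x + r) by rewrite !mulr_ge0//; lra.
have t2 : 0 <= (i + nh) * x ^+ 2 by rewrite mulr_ge0 ?sqr_ge0//; lra.
have t3 : 0 <= (i + nn) * x * (x + r) by rewrite !mulr_ge0//; lra.
have t4 : 0 <= i * d * r by rewrite !mulr_ge0// ltW.
have t5 : 0 <= x * ((i + nn) * (a - 2 * L) - (i + nh) * a) by rewrite mulr_ge0// ltW.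
(* All terms of the loss are nonnegative. If [x = 0], the pair differs from the optimizer only by
   [r > 0], and [i * d * r] is strict; otherwise the term with the marginal gap is. *)
have [xE|xneq] := eqVneq x 0.
  have r1 : 0 < r.
    rewrite lt_neqAle r0 andbT; apply/eqP => rE; apply: neq.
    by rewrite yE xE -rE !subr0.
  suff : 0 < i * d * r by lra.
  by rewrite !mulr_gt0.
suff : 0 < x * ((i + nn) * (a - 2 * L) - (i + nh) * a) by lra.
by rewrite mulr_gt0// lt_neqAle eq_sym xneq.
Qed.

Lemma argmax_uniform :
  argmax (unif_feasible i delta a) (fun l => levy_revenue wI wN i nh nn D m (l, l))
  = [set delta * a / (2 * i)].
Proof.
move: i0 nh0 nhn => i_gt0 nh_gt0 nh_lt.
have a0 : 0 < a by rewrite subr_gt0.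
have d0 : 0 < d by rewrite subr_gt0.
have /andP := levy_cap_lt_half.
have -> : delta * a / (2 * i) = delta / i / 2 * a by field; rewrite gt_eqF.
set e := delta / i => -[e0 e1].
have ea : 0 <= e / 2 * a <= a by apply/andP; split; nra.
apply: argmax_unique => [|l /= [lc /andP[l0 la]] neq].
  split=> //; rewrite /e (_ : _ * _ = delta * a)//; field.
  by rewrite gt_eqF.
rewrite !levy_revenueE//= ?l0 ?la// ltr_pM2l//.
have lL : l < e / 2 * a.
  rewrite lt_neqAle; apply/andP; split; first exact/eqP.
  have -> : e / 2 * a = delta * a / (2 * i) by rewrite /e; field; rewrite gt_eqF.
  by rewrite ler_pdivlMr ?mulr_gt0// mulrC.
set L := e / 2 * a in lL ea neq *.
have L2 : 2 * L < a by rewrite /L; nra.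
rewrite -subr_gt0.
(* The loss factors through [L - l]; the cofactor is positive because [l < L] and [2 * L < a]. *)
have -> : i * d * (L + L) + (i + nh) * L * (a - L) + (i + nn) * L * (a - L) -
   (i * d * (l + l) + (i + nh) * l * (a - l) + (i + nn) * l * (a - l)) =
   (L - l) * (2 * i * d + (2 * i + nh + nn) * (a - L - l)) by ring.
rewrite mulr_gt0 ?subr_gt0// addr_gt0 ?mulr_gt0//; lra.
Qed.

Lemma maxval_directional :
  maxval (dir_feasible i delta a) (levy_revenue wI wN i nh nn D m) =
  m * (delta * d * a + (i + nn) * a ^+ 2 * (delta / i - delta ^+ 2 / i ^+ 2)).
Proof.
have max : argmax (dir_feasible i delta a) (levy_revenue wI wN i nh nn D m)
    (0, delta * a / i) by rewrite argmax_directional.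
rewrite (maxval_argmax max).
case: max => -[/= _ _ la] _.
rewrite levy_revenueE//= ?lexx ?subr_ge0 ?(ltW DwN)//.
by congr (m * _); field; rewrite gt_eqF.
Qed.

Lemma maxval_uniform :
  maxval (unif_feasible i delta a) (fun l => levy_revenue wI wN i nh nn D m (l, l)) =
  m * (delta * d * a + (i + nh + (i + nn)) * a ^+ 2 *
        (delta / (2 * i) - delta ^+ 2 / (2 * i) ^+ 2)).
Proof.
have max : argmax (unif_feasible i delta a)
    (fun l => levy_revenue wI wN i nh nn D m (l, l)) (delta * a / (2 * i)).
  by rewrite argmax_uniform.
rewrite (maxval_argmax max).
case: max => -[/= _ la] _.
rewrite levy_revenueE//=.
by congr (m * _); field; rewrite gt_eqF.
Qed.

End LevyPrograms.

(** After division by [e = delta / i], write [cn = i + nn]. From [i + nh < cn * (1 - 2 * e)] the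
    uniform coefficient is below [cn * (1 - e) * (1 - e / 2)], hence below the directional one,
    [cn * (1 - e)]. *)
Lemma levy_capacity_lt (R : realType) (i nh nn delta : R) :
  0 < i -> 0 < nh -> nh < nn -> 0 < delta ->
  delta < i * (nn - nh) / (2 * (i + nn)) ->
  0 < (i + nh + (i + nn)) * (delta / (2 * i) - delta ^+ 2 / (2 * i) ^+ 2)
    < (i + nn) * (delta / i - delta ^+ 2 / i ^+ 2).
Proof.
move=> i0 nh0 nhn delta0 dbar.
have := levy_cap_lt i0 nh0 nhn dbar.
have := levy_cap_lt_half i0 nh0 nhn delta0 dbar.
have -> : delta / (2 * i) - delta ^+ 2 / (2 * i) ^+ 2 =
  delta / i * (1 / 2 - delta / i / 4) by field; lra.
have -> : delta / i - delta ^+ 2 / i ^+ 2 = delta / i * (1 - delta / i) by field; lra.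
set e := delta / i => /andP[e0 e1] ecap.
rewrite ![_ * (e * _)]mulrCA ltr_pM2l// mulr_gt0//=; first nra.
by rewrite mulr_gt0; lra.
Qed.

(** * Attained maxima and break-even sets *)

Lemma ratio_argmax (R : realType) (K b0 : R) (P : R -> R) :
  0 < b0 -> (forall b, b0 <= b -> {for b, continuous P}) -> P b0 = 0 ->
  (forall b, b0 < b -> 0 < P b <= K / b) ->
  exists b, argmax [set b | b0 < b] P b.
Proof.
move=> b0_gt0 Pc P0 PK.
have := PK (b0 + 1); rewrite ltrDl => /(_ ltr01).
set p := P (b0 + 1) => /andP[p0 pK].
have K0 : 0 < K.
  rewrite -(@pmulr_lgt0 _ (b0 + 1)^-1); first exact: lt_le_trans pK.
  by rewrite invr_gt0; lra.
(* Beyond [B] the bound [K / b] is below the value [p] already reached at [b0 + 1], so the maximum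
   over [[b0, B]] is global. *)
pose B := b0 + 1 + K / p.
have Kp : 0 < K / p by rewrite divr_gt0.
have b0B : b0 <= B by rewrite /B; lra.
have [|c /[!in_itv]/= /andP[b0c cB] cmax] := @EVT_max R P b0 B b0B.
  by apply: continuous_in_subspaceT => y /[!inE]/=; rewrite in_itv/= => /andP[? _]; exact: Pc.
have pc : p <= P c by apply: cmax; rewrite in_itv/= /B; lra.
exists c; split=> /= [|b b0b].
  rewrite lt_neqAle b0c andbT; apply/eqP => e.
  by move: pc; rewrite -e P0 leNgt p0.
have [bB|Bb] := leP b B; first by apply: cmax; rewrite in_itv/= bB ltW.
have b_gt0 : 0 < b by lra.
have /andP[_ /le_trans] := PK _ b0b; apply; apply: le_trans pc.
rewrite ler_pdivrMr// mulrC -ler_pdivrMr//.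
by rewrite /B in Bb; lra.
Qed.

Section Breakeven.
Variables (R : realType) (b0 K : R) (PD PU : R -> R).
Hypotheses (b0_gt0 : 0 < b0).
Hypothesis PDc : forall b, b0 <= b -> {for b, continuous PD}.
Hypothesis PUc : forall b, b0 <= b -> {for b, continuous PU}.
Hypotheses (PD0 : PD b0 = 0) (PU0 : PU b0 = 0).
Hypothesis PUD : forall b, b0 < b -> 0 < PU b < PD b.
Hypothesis PDK : forall b, b0 < b -> PD b <= K / b.
Let SD := maxval [set b | b0 < b] PD.
Let SU := maxval [set b | b0 < b] PU.
Let BD (m : R) := [set b | b0 < b /\ 1 <= m * PD b].
Let BU (m : R) := [set b | b0 < b /\ 1 <= m * PU b].

(** A scale [m > 0] breaks even somewhere exactly when [m] times the attained maximum is at least 1.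
    The pointwise order of [PU] and [PD] gives the inclusion of the sets. *)
Lemma breakeven_sets :
  [/\ exists2 b : R, argmax [set b | b0 < b] PD b & PD b = SD,
      exists2 b : R, argmax [set b | b0 < b] PU b & PU b = SU &
      0 < SU < SD] /\
  [/\ forall m : R, 0 < m -> m < 1 / SD -> BD m = set0 /\ BU m = set0,
      forall m : R, 1 / SD <= m -> m < 1 / SU -> BD m !=set0 /\ BU m = set0 &
      forall m : R, 1 / SU <= m -> BU m `<` BD m].
Proof.
have PD_gt0 b : b0 < b -> 0 < PD b by move=> /PUD /andP[]; exact: lt_trans.
have [bD maxD] : exists b, argmax [set b | b0 < b] PD b.
  by apply: (@ratio_argmax _ K) => // b b0b; rewrite PD_gt0// PDK.
have [bU maxU] : exists b, argmax [set b | b0 < b] PU b.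
  apply: (@ratio_argmax _ K) => // b b0b.
  have /andP[-> /ltW] := PUD b0b; move=> /le_trans; apply; exact: PDK.
have ED : SD = PD bD := maxval_argmax maxD.
have EU : SU = PU bU := maxval_argmax maxU.
case: (maxD) => /= bD0 leD; case: (maxU) => /= bU0 leU.
have /andP[SU0 SUlt] := PUD bU0; rewrite -EU in SU0 SUlt.
(* At the maximizer of [PU], the value of [PD] is already larger than [SU]. *)
have SUD : SU < SD by rewrite ED; exact: lt_le_trans SUlt (leD _ bU0).
have SD0 : 0 < SD := lt_trans SU0 SUD.
have sub m : 0 < m -> BU m `<=` BD m.
  move=> m0 b [b0b /le_trans h]; split=> //; apply: h.
  by rewrite ler_pM2l//; have /andP[_ /ltW] := PUD b0b.
have BDE m : 0 < m -> m < 1 / SD -> BD m = set0.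
  move=> m0; rewrite ltr_pdivlMr// => mS; apply/seteqP; split=> // b [b0b].
  rewrite leNgt => /negP; apply; apply: le_lt_trans mS.
  by rewrite ler_pM2l// ED leD.
have BUE m : 0 < m -> m < 1 / SU -> BU m = set0.
  move=> m0; rewrite ltr_pdivlMr// => mS; apply/seteqP; split=> // b [b0b].
  rewrite leNgt => /negP; apply; apply: le_lt_trans mS.
  by rewrite ler_pM2l// EU leU.
split; first by split; [exists bD | exists bU | rewrite SU0].
split=> [m m0 mD|m mD mU|m mU].
- have BD0 := BDE m m0 mD; split=> //.
  by apply/seteqP; split=> // b /(sub _ m0); rewrite BD0.
- have m0 : 0 < m by apply: lt_le_trans mD; rewrite divr_gt0.
  split; last exact: BUE.
  by exists bD; split=> //; rewrite -ED -ler_pdivrMr.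
- have m0 : 0 < m by apply: lt_le_trans mU; rewrite divr_gt0.
  split; first exact: sub.
  (* Since [PD b0 = 0 < 1 / m <= PU bU < PD bU], [PD] takes the value [1 / m],
     at a point where [PU] is smaller. *)
  have mPD : 1 / m <= PD bU.
    apply: le_trans (ltW SUlt); rewrite ler_pdivrMr// mulrC -ler_pdivrMr//.
  have [||c /[!in_itv]/= /andP[b0c _] cE] := @IVT R PD b0 bU (1 / m) (ltW bU0).
  + by apply: continuous_in_subspaceT => y /[!inE]/=; rewrite in_itv/= => /andP[? _]; exact: PDc.
  + by rewrite PD0 ge_min le_max mPD orbT divr_ge0// ltW.
  have {}b0c : b0 < c.
    rewrite lt_neqAle b0c andbT; apply/eqP => e.
    by move: cE; rewrite -e PD0 => /esym/eqP; rewrite gt_eqF// divr_gt0.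
  have mPc : m * PD c = 1 by rewrite cE mul1r divff// gt_eqF.
  move=> /(_ c)[]; first by split=> //; rewrite mPc.
  move=> _; rewrite leNgt -mPc ltr_pM2l//.
  by have /andP[_ ->] := PUD b0c.
Qed.

End Breakeven.

(** * Comparison of the directional and uniform markets *)

Theorem theorem3 (R : realType) (z wN wI i nh nn delta : R)
  (hz : 0 < z) (hwN : 0 < wN) (hwNI : wN < wI) (hwI : wI <= z / 2)
  (hi : 0 < i) (hnh : 0 < nh) (hnhn : nh < nn)
  (hdelta : 0 < delta)
  (hdeltabar : delta < i * (nn - nh) / (2 * (i + nn))) :
  let d := wI - wN in
  let ch := i + nh in
  let cn := i + nn in
  let I := 2 * i in
  let C := ch + cn in
  let D := lmsr_cost z in
  let a := fun b : R => wN - D b in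
  let Gamma := fun (b m : R) (l : R * R) =>
    levy_revenue wI wN i nh nn (D b) m l in
  let feasD := fun b : R => dir_feasible i delta (a b) in
  let feasU := fun b : R => unif_feasible i delta (a b) in
  let GammaD := fun b m : R => maxval (feasD b) (Gamma b m) in
  let GammaU := fun b m : R => maxval (feasU b) (fun l : R => Gamma b m (l, l)) in
  let GD := fun b : R => GammaD b 1 in
  let GU := fun b : R => GammaU b 1 in
  let PsiD := fun b : R => GD b / (b * ln 2) in
  let PsiU := fun b : R => GU b / (b * ln 2) in
  exists b0 : R,
    unique (fun b : R => 0 < b /\ D b = wN) b0 /\
    (forall b : R, b0 < b -> 0 < a b) /\
    (forall m b : R, 0 < m -> b0 < b ->
      [/\ argmax (feasD b) (Gamma b m) = [set (0, delta * a b / i)],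
          argmax (feasU b) (fun l : R => Gamma b m (l, l)) =
            [set delta * a b / (2 * i)],
          GammaD b m = m * GD b &
          GammaU b m = m * GU b]) /\
    (forall b : R, b0 < b ->
      [/\ GD b = delta * d * a b
                 + cn * a b ^+ 2 * (delta / i - delta ^+ 2 / i ^+ 2),
          GU b = delta * d * a b
                 + C * a b ^+ 2 * (delta / I - delta ^+ 2 / I ^+ 2) &
          0 < GU b < GD b]) /\
    let SD := maxval [set b | b0 < b] PsiD in
    let SU := maxval [set b | b0 < b] PsiU in
    let BD := fun m : R => [set b | b0 < b /\ b * ln 2 <= m * GD b] in
    let BU := fun m : R => [set b | b0 < b /\ b * ln 2 <= m * GU b] in
    [/\ exists2 b : R, argmax [set b | b0 < b] PsiD b & PsiD b = SD,
        exists2 b : R, argmax [set b | b0 < b] PsiU b & PsiU b = SU &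
        0 < SU < SD] /\
    [/\ forall m : R, 0 < m -> m < 1 / SD -> BD m = set0 /\ BU m = set0,
        forall m : R, 1 / SD <= m -> m < 1 / SU -> BD m !=set0 /\ BU m = set0 &
        forall m : R, 1 / SU <= m -> BU m `<` BD m].
Proof.
move=> d ch cn I C D a Gamma feasD feasU GammaD GammaU GD GU PsiD PsiU.
have wN0z : 0 < wN < z / 2 by rewrite hwN; lra.
have [b0 b0_gt0 Db0] := lmsr_cost_surj hz wN0z.
have Dlt b c : 0 < b -> b < c -> D c < D b by exact: lmsr_cost_lt.
have gt0 b : b0 < b -> 0 < b by exact: lt_trans.
have D_gt0 b : b0 < b -> 0 < D b by move=> /gt0; exact: lmsr_cost_gt0.
have DwN b : b0 < b -> D b < wN by move=> b0b; rewrite -Db0; exact: Dlt.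
have a_gt0 b : b0 < b -> 0 < a b by move=> b0b; rewrite subr_gt0 DwN.
exists b0; split.
  split=> // b [b_gt0 Db]; case: (ltgtP b0 b) => // [/DwN|bb0]; first by rewrite Db ltxx.
  by have := Dlt _ _ b_gt0 bb0; rewrite Db [D b0]Db0 ltxx.
pose kD := cn * (delta / i - delta ^+ 2 / i ^+ 2).
pose kU := C * (delta / I - delta ^+ 2 / I ^+ 2).
have /andP[kU0 kUD] : 0 < kU < kD by exact: levy_capacity_lt.
have GammaDE b m : 0 < m -> b0 < b -> GammaD b m = m * (delta * d * a b + kD * a b ^+ 2).
  move=> m0 b0b; rewrite [LHS]maxval_directional ?D_gt0 ?DwN//.
  by rewrite /kD /cn /d /a /D; congr (m * (_ + _)); rewrite mulrAC.
have GammaUE b m : 0 < m -> b0 < b -> GammaU b m = m * (delta * d * a b + kU * a b ^+ 2).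
  move=> m0 b0b; rewrite [LHS]maxval_uniform ?D_gt0 ?DwN//.
  by rewrite /kU /C /ch /cn /I /d /a /D; congr (m * (_ + _)); rewrite mulrAC.
have GDE b : b0 < b -> GD b = delta * d * a b + kD * a b ^+ 2.
  by move=> b0b; rewrite [LHS]GammaDE// mul1r.
have GUE b : b0 < b -> GU b = delta * d * a b + kU * a b ^+ 2.
  by move=> b0b; rewrite [LHS]GammaUE// mul1r.
have dd0 : 0 < delta * d by rewrite mulr_gt0// subr_gt0.
have GUD b : b0 < b -> 0 < GU b < GD b.
  move=> b0b; rewrite GUE// GDE//.
  have a0 := a_gt0 b b0b.
  rewrite ltrD2l ltr_pM2r ?exprn_gt0// kUD andbT.
  by apply: addr_gt0; rewrite mulr_gt0 ?exprn_gt0.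
split=> //; split.
  move=> m b m0 b0b; split.
  - by apply: argmax_directional => //; [exact: D_gt0 | exact: DwN].
  - by apply: argmax_uniform => //; [exact: D_gt0 | exact: DwN].
  - by rewrite GammaDE// GDE.
  - by rewrite GammaUE// GUE.
split.
  move=> b b0b; split; last exact: GUD.
  - by rewrite GDE// /kD; congr (_ + _); rewrite mulrAC.
  - by rewrite GUE// /kU; congr (_ + _); rewrite mulrAC.
move=> SD SU BD BU.
have l2 : 0 < ln 2 :> R by rewrite ln_gt0// ltr1n.
(* The ratios are replaced by explicit formulas, which agree with them for [b0 < b] and are
   continuous and zero at [b0] itself. *)
pose Q k b := (delta * d * a b + k * a b ^+ 2) / (b * ln 2).
have Qc k b : b0 <= b -> {for b, continuous (Q k)}.
  move=> b0b; have b_gt0 : 0 < b by exact: lt_le_trans b0b.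
  have ac : a y @[y --> b] --> a b.
    by apply: cvgB; [exact: cvg_cst | exact: continuous_lmsr_cost].
  apply: cvgM.
    apply: cvgD; apply: cvgM => //; first exact: cvg_cst.
      exact: cvg_cst.
    by rewrite expr2; apply: cvgM.
  apply: cvgV; first by rewrite mulf_neq0 ?gt_eqF.
  by apply: cvgM; [exact: cvg_id | exact: cvg_cst].
have Q0 k : Q k b0 = 0.
  by rewrite /Q /a [D b0]Db0 subrr expr0n/= !mulr0 addr0 mul0r.
have PsiDE b : b0 < b -> PsiD b = Q kD b by move=> b0b; rewrite /PsiD GDE.
have PsiUE b : b0 < b -> PsiU b = Q kU b by move=> b0b; rewrite /PsiU GUE.
have bl2 b : b0 < b -> 0 < b * ln 2 by move=> /gt0 ?; rewrite mulr_gt0.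
have QUD b : b0 < b -> 0 < Q kU b < Q kD b.
  move=> b0b; rewrite -PsiUE// -PsiDE//; have /andP[h1 h2] := GUD b b0b.
  by rewrite divr_gt0 ?bl2//= ltr_pM2r// invr_gt0 bl2.
(* Positivity of the cost gives [a b <= wN], so the numerator is bounded and the ratio is
   [O(1 / b)]. *)
have QK b : b0 < b -> Q kD b <= (delta * d * wN + kD * wN ^+ 2) / ln 2 / b.
  move=> b0b; rewrite -mulrA -invfM [ln 2 * b]mulrC ler_pM2r ?invr_gt0 ?bl2//.
  have aw : a b <= wN by rewrite gerBl ltW// D_gt0.
  have a0 := a_gt0 b b0b.
  apply: lerD; first by rewrite ler_pM2l.
  rewrite ler_pM2l; last exact: lt_trans kUD.
  by rewrite ler_sqr ?nnegrE ?(ltW a0) ?(ltW hwN).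
have [] := breakeven_sets b0_gt0 (Qc kD) (Qc kU) (Q0 kD) (Q0 kU) QUD QK.
rewrite -(eq_maxval PsiDE) -(eq_maxval PsiUE) -(eq_argmax PsiDE) -(eq_argmax PsiUE).
move=> [[bD maxD eD] [bU maxU eU] S] H.
split.
  split=> //.
  - by exists bD => //; rewrite /SD (maxval_argmax maxD).
  - by exists bU => //; rewrite /SU (maxval_argmax maxU).
(* Dividing by the seed capital [b * ln 2 > 0] puts the break-even condition in ratio form. *)
have BE G k m : (forall b, b0 < b -> G b / (b * ln 2) = Q k b) ->
    [set b | b0 < b /\ b * ln 2 <= m * G b] = [set b | b0 < b /\ 1 <= m * Q k b].
  move=> GE; apply/seteqP; split=> b /= [b0b h]; split=> //; move: h;
    by rewrite -GE// mulrA ler_pdivlMr ?bl2// mul1r.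
have -> : BD = fun m => [set b | b0 < b /\ 1 <= m * Q kD b].
  by apply/funext => m; exact: BE.
have -> : BU = fun m => [set b | b0 < b /\ 1 <= m * Q kU b].
  by apply/funext => m; exact: BE.
exact: H.
Qed.
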